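(* Let $m\ge 2$, let $a=\mathrm{Tr}(A_0^{-1})$ and $b=\mathrm{Tr}(A_0^{-2})$ for some real symmetric positive definite $m\times m$ matrix $A_0$, and let $q$ be the integer satisfying $q<a^2/b\le q+1$. Let $F$ be the set of all tuples $(\lambda_1,\dots,\lambda_m)$ with $\lambda_k\in(0,+\infty]$, $\lambda_1\ge\lambda_2\ge\cdots\ge\lambda_m$, $\sum_{k=1}^m 1/\lambda_k=a$ and $\sum_{k=1}^m 1/\lambda_k^2=b$. Then, over $F$, the quantity $\lambda_m$ takes a maximum when $\lambda_1=\cdots=\lambda_{m-q-1}=+\infty$ and $\lambda_{m-q+1}=\cdots=\lambda_m$ (that is, the maximum exists and is attained at an element of $F$ of this form), and the maximum value is $$\lambda_m^*=\frac{1}{a}\cdot\frac{q(q+1)}{q+\sqrt{q\left[(q+1)\cdot\frac{b}{a^2}-1\right]}}.$$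
   Context: Eigenvalues are numbered in decreasing order, so $\lambda_m$ is the smallest. Infinite eigenvalues are allowed: eigenvalues take values in $(0,+\infty]$ with the convention $1/(+\infty)=0$, and the elements of $F$ are the (extended) spectra compatible with the prescribed values $\mathrm{Tr}(A^{-1})=\sum_k 1/\lambda_k=a$ and $\mathrm{Tr}(A^{-2})=\sum_k 1/\lambda_k^2=b$. When $q=m-1$ the condition $\lambda_1=\cdots=\lambda_{m-q-1}=+\infty$ is empty; when $q=1$ the condition $\lambda_{m-q+1}=\cdots=\lambda_m$ is trivially satisfied. *)

(* Defs.v *)
From HB Require Import structures.
From mathcomp Require Import all_boot all_order all_algebra.
From mathcomp Require Import sesquilinear.
From mathcomp Require Import classical_sets reals constructive_ereal.

Set Implicit Arguments.
Unset Strict Implicit.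
Unset Printing Implicit Defensive.

Import Order.TTheory GRing.Theory Num.Theory.

Local Open Scope classical_set_scope.
Local Open Scope ring_scope.

Definition posdefmx (R : realType) (m : nat) (A : 'M[R]_m) : Prop :=
  A \is symmetricmx /\
  forall v : 'cV[R]_m, v != 0 -> 0 < (v^T *m A *m v) 0 0.

(* lambda_k for 1 <= k <= m: the indices are 1-based, whereas [nth] is 0-based;
   the values at k = 0 and k > m are meaningless. *)
Definition eigv (R : realType) (m : nat) (l : m.-tuple (\bar R)) (k : nat) :
    \bar R :=
  nth +oo%E l k.-1.

(* The inverse of \bar R satisfies +oo^-1 = 0, which is the convention
   1 / (+oo) = 0; the junk value 0^-1 = +oo is excluded by positivity. *)
Definition spectra (R : realType) (m : nat) (a b : R) :
    set (m.-tuple (\bar R)) :=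
  [set l | [/\ forall k : nat, (1 <= k <= m)%N -> (0 < eigv l k)%E,
               forall j k : nat, (1 <= j)%N -> (j <= k)%N -> (k <= m)%N ->
                 (eigv l k <= eigv l j)%E,
               (\sum_(1 <= k < m.+1) (eigv l k)^-1)%E = a%:E
             & (\sum_(1 <= k < m.+1) ((eigv l k) ^+ 2)^-1)%E = b%:E]].

Arguments spectra {R} m a b.

(* Main.v *)
Require Import Defs.
From HB Require Import structures.
From mathcomp Require Import all_boot all_order all_algebra.
From mathcomp Require Import sesquilinear.
From mathcomp Require Import classical_sets reals constructive_ereal.
From mathcomp Require Import ring lra zify.

Set Implicit Arguments.
Unset Strict Implicit.
Unset Printing Implicit Defensive.

Import Order.TTheory GRing.Theory Num.Theory.

Local Open Scope classical_set_scope.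
Local Open Scope ring_scope.

(** The reciprocals [mu_k = 1 / lambda_k] form a nondecreasing sequence of
    finite nonnegative numbers with prescribed sum [a] and prescribed sum of
    squares [b], and maximizing [lambda_m] amounts to minimizing the largest
    reciprocal [mu_m].

    Under an upper bound on its entries, a nonnegative sequence of given sum
    has the largest sum of squares when it is as concentrated as possible: as
    many entries as possible equal to the bound, one remainder, and zeros. The
    smallest bound compatible with [b] is therefore the one for which this
    concentrated sequence [z] = (0, ..., 0, x, y, ..., y), with [q] copies of
    [y], has sum of squares exactly [b]. Solving [x + q y = a] and
    [x^2 + q y^2 = b] gives the closed formula, and [q < a^2 / b <= q + 1] is
    what makes [0 < x <= y] (lemma [two_level_solution]).

    Optimality of [y] (lemma [step_profile_max_le]) is a direct comparison of
    an arbitrary feasible [mu] with [z]: if [mu_m < y], then [mu] lies below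
    [z] after the index of [x] and above it before, and this forces
    [\sum_k mu_k^2 < \sum_k z_k^2], against the constraint.

    The matrix [A0] makes [a] and [b] positive and places [q] between 1 and
    [m - 1], so that the concentrated sequence fits in [m] entries. With [B]
    the inverse of [A0], the position of [q] follows from
    [\tr (B^2) < (\tr B)^2 <= m \tr (B^2)]
    (lemmas [posdefmx_trace_sqr_lt] and [trace_sqr_le]), which is proved from
    the entries of [B], without diagonalizing it. *)

(** * Traces of a positive definite matrix and of its square *)

Lemma posdefmx_tr (R : realType) (m : nat) (A : 'M[R]_m) :
  posdefmx A -> A^T = A.
Proof.
by case=> /is_hermitianmxP; rewrite expr0 scale1r map_mx_id // => {2}->.
Qed.

Lemma posdefmx_unit (R : realType) (m : nat) (A : 'M[R]_m) :
  posdefmx A -> A \in unitmx.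
Proof.
case=> _ Apos; rewrite -row_free_unit -kermx_eq0.
apply/rowV0P => v /sub_kermxP vA0; apply/eqP; apply: contraT => v0.
have := Apos v^T; rewrite trmxK vA0 mul0mx mxE ltxx => -> //.
by rewrite -(inj_eq trmx_inj) trmxK trmx0.
Qed.

(** The form of the inverse at [v] is the form of [A] at [invmx A *m v]. *)
Lemma posdefmx_inv (R : realType) (m : nat) (A : 'M[R]_m) :
  posdefmx A -> posdefmx (invmx A).
Proof.
move=> Apd; have Au := posdefmx_unit Apd; have At := posdefmx_tr Apd.
have Bt : (invmx A)^T = invmx A by rewrite trmx_inv At.
split.
  by apply/is_hermitianmxP; rewrite expr0 scale1r map_mx_id.
move=> v v0; have := Apd.2 (invmx A *m v).
rewrite trmx_mul Bt -!mulmxA (mulmxA A) mulmxV // mul1mx mulmxA; apply.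
by apply: contra v0 => /eqP Av0; rewrite -(mulKVmx Au v) Av0 mulmx0.
Qed.

Lemma delta_form (R : comNzRingType) (m : nat) (A : 'M[R]_m) (i j : 'I_m) :
  ((delta_mx i 0 : 'cV[R]_m)^T *m A *m (delta_mx j 0 : 'cV[R]_m)) 0 0 = A i j.
Proof. by rewrite trmx_delta -rowE -colE !mxE. Qed.

Lemma posdefmx_diag_gt0 (R : realType) (m : nat) (A : 'M[R]_m) (i : 'I_m) :
  posdefmx A -> 0 < A i i.
Proof.
case=> _ Apos; rewrite -delta_form; apply: Apos.
apply/eqP => /matrixP /(_ i 0); rewrite !mxE !eqxx => /eqP.
by rewrite oner_eq0.
Qed.

(** The principal 2 x 2 minors are positive: completing the square suggests
    the vector [A j j *: e_i - A i j *: e_j], at which the form takes the value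
    [A j j] times the minor. *)
Lemma posdefmx_minor2 (R : realType) (m : nat) (A : 'M[R]_m) (i j : 'I_m) :
  posdefmx A -> i != j -> A i j ^+ 2 < A i i * A j j.
Proof.
move=> Apd neij; have Ajj := posdefmx_diag_gt0 j Apd.
have Aji : A j i = A i j by rewrite -[in LHS](posdefmx_tr Apd) mxE.
pose v : 'cV[R]_m := A j j *: delta_mx i 0 + (- A i j) *: delta_mx j 0.
have v0 : v != 0.
  apply/eqP => /matrixP /(_ i 0).
  rewrite !mxE !eqxx (negbTE neij) /= mulr1 mulr0 addr0 => Ajj0.
  by rewrite Ajj0 ltxx in Ajj.
have := Apd.2 v v0.
have -> : (v^T *m A *m v) 0 0 = A j j * (A i i * A j j - A i j ^+ 2).
  have addE (M N : 'M[R]_1) : (M + N) 0 0 = M 0 0 + N 0 0 by rewrite mxE.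
  have scaleE c (M : 'M[R]_1) : (c *: M) 0 0 = c * M 0 0 by rewrite mxE.
  have -> : v^T = A j j *: (delta_mx i 0)^T + (- A i j) *: (delta_mx j 0)^T.
    by apply/matrixP => p r; rewrite !mxE.
  rewrite /v !(mulmxDl, mulmxDr).
  rewrite -!(scalemxAl, scalemxAr) !(addE, scaleE) !delta_form Aji.
  by ring.
by rewrite pmulr_rgt0 // subr_gt0.
Qed.

Lemma mxtrace_sqr (R : comNzRingType) (m : nat) (B : 'M[R]_m) :
  B^T = B -> \tr (B *m B) = \sum_i \sum_j B i j ^+ 2.
Proof.
move=> Bt; apply: eq_bigr => i _; rewrite mxE; apply: eq_bigr => j _.
by rewrite -[in X in _ * X]Bt mxE expr2.
Qed.

Lemma posdefmx_trace_gt0 (R : realType) (m : nat) (B : 'M[R]_m) :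
  (0 < m)%N -> posdefmx B -> 0 < \tr B.
Proof.
move=> m0 Bpd; rewrite /mxtrace (bigD1 (Ordinal m0)) //=.
rewrite ltr_pwDl ?posdefmx_diag_gt0 // sumr_ge0 // => i _.
exact/ltW/posdefmx_diag_gt0.
Qed.

Lemma posdefmx_trace_sqr_gt0 (R : realType) (m : nat) (B : 'M[R]_m) :
  (0 < m)%N -> posdefmx B -> 0 < \tr (B *m B).
Proof.
move=> m0 Bpd; rewrite mxtrace_sqr ?posdefmx_tr //.
have sq_ge0 i : 0 <= \sum_j B i j ^+ 2.
  by apply: sumr_ge0 => j _; exact: sqr_ge0.
pose i0 := Ordinal m0; rewrite (bigD1 i0) //= ltr_pwDl ?sumr_ge0 //.
rewrite (bigD1 i0) //= ltr_pwDl ?exprn_gt0 ?posdefmx_diag_gt0 //.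
by apply: sumr_ge0 => j _; exact: sqr_ge0.
Qed.

(** Both sides are double sums over the entries, of [B i j ^+ 2] on the left
    and of [B i i * B j j] on the right; the positive 2 x 2 minors compare them
    term by term, strictly off the diagonal. In terms of eigenvalues this is
    the positivity of the cross terms of [(\sum_k mu_k) ^+ 2]. *)
Lemma posdefmx_trace_sqr_lt (R : realType) (m : nat) (B : 'M[R]_m) :
  (2 <= m)%N -> posdefmx B -> \tr (B *m B) < \tr B ^+ 2.
Proof.
move=> m2 Bpd; rewrite mxtrace_sqr ?posdefmx_tr // expr2 /mxtrace mulr_suml.
have le_ij i j : B i j ^+ 2 <= B i i * B j j.
  have [->|neij] := eqVneq i j; first by rewrite expr2.
  exact/ltW/posdefmx_minor2.
pose i0 := Ordinal (ltnW m2); pose i1 := Ordinal m2.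
rewrite [ltLHS](bigD1 i0) // [ltRHS](bigD1 i0) //=; apply: ltr_leD; last first.
  by apply: ler_sum => i _; rewrite mulr_sumr; exact: ler_sum.
rewrite mulr_sumr [ltLHS](bigD1 i1) // [ltRHS](bigD1 i1) //=.
by apply: ltr_leD; [exact: posdefmx_minor2 | exact: ler_sum].
Qed.

(** Cauchy-Schwarz on the diagonal of [B], read off from the nonnegative sum
    of the squares of [m%:R * B i i - \tr B]. *)
Lemma trace_sqr_le (R : realDomainType) (m : nat) (B : 'M[R]_m) :
  B^T = B -> \tr B ^+ 2 <= m%:R * \tr (B *m B).
Proof.
move=> Bt; rewrite mxtrace_sqr //; set t := \tr B.
have [m0|m0] := posnP m.
  have -> : t = 0 by apply: big1 => i; move: (ltn_ord i); rewrite {2}m0.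
  have -> : m%:R = 0 :> R by rewrite m0.
  by rewrite mul0r expr0n.
have mR : 0 < m%:R :> R by rewrite ltr0n.
have diag_le : \sum_i B i i ^+ 2 <= \sum_i \sum_j B i j ^+ 2.
  apply: ler_sum => i _; rewrite [leRHS](bigD1 i) //= lerDl sumr_ge0 // => j _.
  exact: sqr_ge0.
apply: le_trans (ler_wpM2l (ltW mR) diag_le).
have : 0 <= \sum_i (m%:R * B i i - t) ^+ 2.
  by apply: sumr_ge0 => i _; exact: sqr_ge0.
have -> : \sum_i (m%:R * B i i - t) ^+ 2 =
    m%:R * (m%:R * \sum_i B i i ^+ 2 - t ^+ 2).
  transitivity
    (\sum_i (m%:R ^+ 2 * B i i ^+ 2 - 2 * m%:R * t * B i i + t ^+ 2)).
    by apply: eq_bigr => i _; ring.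
  rewrite big_split sumrB -!mulr_sumr sumr_const card_ord -/(mxtrace B) -/t /=.
  by rewrite -mulr_natl; ring.
by rewrite pmulr_rge0 // subr_ge0.
Qed.

(** * The extremal distribution of the reciprocals *)

(** The most concentrated sequence with entries at most [y], in increasing
    order when [0 <= x <= y]; the index [d] carries the remainder [x]. *)
Definition step_profile (R : realDomainType) (d : nat) (x y : R) (k : nat) :
    R :=
  if (k < d)%N then 0 else if k == d then x else y.

Lemma sum_step_profile (R : realDomainType) (m d : nat) (x y : R) (F : R -> R) :
  (1 <= d <= m)%N -> F 0 = 0 ->
  \sum_(1 <= k < m.+1) F (step_profile d x y k) = F x + (m - d)%:R * F y.
Proof.
case/andP=> d1 dm F0; rewrite (@big_cat_nat _ _ _ d) //=; last by lia.
rewrite big_nat_cond big1 ?add0r; last first.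
  by move=> k /andP[/andP[_ kd] _]; rewrite /step_profile kd.
rewrite big_ltn ?ltnS // {1}/step_profile ltnn eqxx; congr (_ + _).
rewrite mulr_natl (eq_big_nat _ _ (F2 := fun=> F y)) ?sumr_const_nat ?subSS //.
by move=> k /andP[dk _]; rewrite /step_profile ltnNge ltnW //= gtn_eqF.
Qed.

(** Suppose [mu m < y], and let [z] be the step profile. The sign of
    [z k - mu k] is then the sign of [k - d], apart from [k = d], so that it
    agrees with that of [mu k - mu d]. Since
    [z k ^+ 2 - mu k ^+ 2 - 2 * mu d * (z k - mu k)] equals
    [(z k - mu k) ^+ 2 + 2 * (mu k - mu d) * (z k - mu k)],
    summing over [k] makes the left side vanish, by the two constraints, while
    the right side is at least [(y - mu m) ^+ 2 > 0]. *)
Lemma step_profile_max_le (R : realDomainType) (m d : nat) (x y : R)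
    (mu : nat -> R) :
  (1 <= d < m)%N ->
  (forall k, (1 <= k <= m)%N -> 0 <= mu k) ->
  (forall j k, (1 <= j)%N -> (j <= k)%N -> (k <= m)%N -> mu j <= mu k) ->
  \sum_(1 <= k < m.+1) mu k =
    \sum_(1 <= k < m.+1) step_profile d x y k ->
  \sum_(1 <= k < m.+1) mu k ^+ 2 =
    \sum_(1 <= k < m.+1) step_profile d x y k ^+ 2 ->
  y <= mu m.
Proof.
case/andP=> d1 dm mu_ge0 mu_incr sum1 sum2; rewrite leNgt; apply/negP => mu_y.
set z := step_profile d x y in sum1 sum2.
have cross_ge0 k : (1 <= k < m.+1)%N -> 0 <= (mu k - mu d) * (z k - mu k).
  move=> /andP[k1 km]; rewrite /z /step_profile.
  case: ltngtP => kd.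
  - by rewrite mulr_le0 // ?subr_le0 ?mu_incr ?mu_ge0 ?k1 //; lia.
  - rewrite mulr_ge0 // subr_ge0 ?mu_incr //; first exact: ltnW.
    by rewrite (le_trans _ (ltW mu_y)) // mu_incr.
  - by rewrite kd subrr mul0r.
have : \sum_(1 <= k < m.+1) (z k - mu k) ^+ 2 <=
    \sum_(1 <= k < m.+1) (z k ^+ 2 - mu k ^+ 2 - 2 * mu d * (z k - mu k)).
  apply: ler_sum_nat => k /cross_ge0 hk.
  rewrite -subr_ge0 (_ : _ - _ = 2 * ((mu k - mu d) * (z k - mu k))).
    by rewrite mulr_ge0.
  by ring.
rewrite sumrB -mulr_sumr !sumrB -sum1 -sum2 !subrr mulr0 subrr.
rewrite big_nat_recr /=; last by lia.
apply/negP; rewrite -ltNge.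
rewrite ltr_wpDl //; first by apply: sumr_ge0 => k _; exact: sqr_ge0.
have -> : z m = y by rewrite /z /step_profile ltnNge ltnW //= gtn_eqF.
by rewrite exprn_gt0 // subr_gt0.
Qed.

(** Eliminating [x] leaves a quadratic equation in [y], whose larger root is
    the one with [x <= y]. The lower bound on [a ^+ 2 / b] says that the
    radicand is less than 1, hence [x > 0]; the upper bound says that it is
    nonnegative. *)
Lemma two_level_solution (R : rcfType) (N a b : R) :
  0 < N -> 0 < a -> 0 < b -> N < a ^+ 2 / b <= N + 1 ->
  let s := Num.sqrt (N * ((N + 1) * (b / a ^+ 2) - 1)) in
  let x := a * (1 - s) / (N + 1) in
  let y := a * (N + s) / (N * (N + 1)) in
  [/\ 0 < x, x <= y, x + N * y = a & x ^+ 2 + N * y ^+ 2 = b].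
Proof.
move=> N0 a0 b0 /andP[lt_N le_N] s x y.
have Nn0 : N != 0 by rewrite gt_eqF.
have N1 : 0 < N + 1 by rewrite ltr_wpDr.
have N1n0 : N + 1 != 0 by rewrite gt_eqF.
have a_n0 : a != 0 by rewrite gt_eqF.
have a2 : 0 < a ^+ 2 by rewrite exprn_gt0.
rewrite ltr_pdivlMr // in lt_N; rewrite ler_pdivrMr // in le_N.
pose u := N * ((N + 1) * (b / a ^+ 2) - 1).
have u0 : 0 <= u.
  by rewrite mulr_ge0 ?(ltW N0) // subr_ge0 mulrA ler_pdivlMr // mul1r.
have u1 : u < 1.
  have -> : u = 1 + (N + 1) * ((N * b - a ^+ 2) / a ^+ 2).
    by rewrite /u; field.
  by rewrite gtrDl pmulr_rlt0 // pmulr_llt0 ?invr_gt0 // subr_lt0.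
have s0 : 0 <= s by exact: sqrtr_ge0.
have s1 : s < 1 by rewrite -[ltRHS]sqrtr1 /s ltr_sqrt.
have s2 : s ^+ 2 = u by exact: sqr_sqrtr.
split.
- by rewrite divr_gt0 // mulr_gt0 // subr_gt0.
- rewrite -subr_ge0 (_ : y - x = a * s / N).
    by rewrite divr_ge0 ?mulr_ge0 // ltW.
  by rewrite /x /y; field; rewrite ?N1n0 Nn0.
- by rewrite /x /y; field; rewrite N1n0 Nn0.
- transitivity (a ^+ 2 * (1 + s ^+ 2 / N) / (N + 1)).
    by rewrite /x /y; field; rewrite N1n0 Nn0.
  by rewrite s2 /u; field; rewrite ?N1n0 ?Nn0 ?a_n0.
Qed.

(** * Spectra in terms of reciprocals *)

Lemma inve_fin_gt0 (R : realFieldType) (r : R) : 0 <= r -> (0 < r%:E^-1)%E.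
Proof.
move=> r0; rewrite inver; case: eqP => [_|/eqP rn0]; first exact: ltry.
by rewrite lte_fin invr_gt0 lt_neqAle eq_sym rn0.
Qed.

Lemma inve_fin_le (R : realFieldType) (r s : R) : 0 <= r -> 0 <= s ->
  (s%:E^-1 <= r%:E^-1)%E = (r <= s).
Proof.
move=> r0 s0; rewrite !inver.
case: (eqVneq s 0) => [->|sn0]; case: (eqVneq r 0) => [->|rn0].
- by rewrite !lexx.
- by rewrite leye_eq /= [RHS]le_eqVlt (negbTE rn0) ltNge r0.
- by rewrite leey s0.
- by rewrite lee_fin lef_pV2 // posrE lt_neqAle eq_sym ?rn0 ?sn0.
Qed.

(** At [r = 0] both sides are 0, the left one through the value [+oo]. *)
Lemma inve_sqr_inve_fin (R : realFieldType) (r : R) : 0 <= r ->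
  (((r%:E^-1) ^+ 2)^-1)%E = (r ^+ 2)%:E.
Proof.
move=> r0; rewrite expe2 inver; case: (eqVneq r 0) => [->|rn0].
  by rewrite mulyy invey expr0n.
by rewrite -EFinM inver mulf_eq0 invr_eq0 orbb (negbTE rn0) invfM !invrK.
Qed.

Lemma inve_fine_inve (R : realFieldType) (x : \bar R) : (0 < x)%E ->
  0 <= fine x^-1%E /\ x = ((fine x^-1)%:E^-1)%E.
Proof.
move=> x0; split; first by rewrite fine_ge0 // inve_ge0 ltW.
rewrite fineK ?inveK // fin_numV ?gt_eqF //.
by rewrite (lt_trans _ x0) // ltNy0.
Qed.

(** Reciprocals turn the extended spectra into finite nonnegative
    nondecreasing real sequences, an infinite eigenvalue becoming 0, so that
    the constraints are a linear and a quadratic equation over the reals. *)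
Lemma spectraP (R : realType) (m : nat) (a b : R) (l : m.-tuple (\bar R)) :
  l \in spectra m a b <->
  exists mu : nat -> R,
    [/\ forall k, (1 <= k <= m)%N -> 0 <= mu k /\ eigv l k = ((mu k)%:E^-1)%E,
        forall j k, (1 <= j)%N -> (j <= k)%N -> (k <= m)%N -> mu j <= mu k,
        \sum_(1 <= k < m.+1) mu k = a
      & \sum_(1 <= k < m.+1) mu k ^+ 2 = b].
Proof.
rewrite inE; split.
- case=> l_gt0 l_decr sum1 sum2; exists (fun k => fine (eigv l k)^-1%E).
  have muP k : (1 <= k < m.+1)%N -> 0 <= fine (eigv l k)^-1%E /\
      eigv l k = ((fine (eigv l k)^-1)%:E^-1)%E.
    by move=> km; exact/inve_fine_inve/l_gt0.
  split.
  + exact: muP.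
  + move=> j k j1 jk km; have := l_decr j k j1 jk km.
    have [|muj {1}->] := muP j; first by lia.
    have [|muk {1}->] := muP k; first by lia.
    by rewrite inve_fin_le.
  + apply: EFin_inj; rewrite -sum1 -sumEFin.
    apply: eq_big_nat => k /muP[_ {2}->].
    by rewrite inveK.
  + apply: EFin_inj; rewrite -sum2 -sumEFin.
    apply: eq_big_nat => k /muP[mu0 {2}->].
    by rewrite inve_sqr_inve_fin.
- case=> mu [muP mu_incr sum1 sum2]; split.
  + by move=> k /muP[mu0 ->]; exact: inve_fin_gt0.
  + move=> j k j1 jk km.
    have [|muj ->] := muP j; first by lia.
    have [|muk ->] := muP k; first by lia.
    by rewrite inve_fin_le // mu_incr.
  + rewrite -sum1 -sumEFin; apply: eq_big_nat => k /muP[_ ->].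
    by rewrite inveK.
  + rewrite -sum2 -sumEFin; apply: eq_big_nat => k /muP[mu0 ->].
    exact: inve_sqr_inve_fin.
Qed.

(** * The maximal smallest eigenvalue *)

Theorem theorem3p2 (R : realType) (m : nat) (hm : (2 <= m)%N)
  (A0 : 'M[R]_m) (hA0 : posdefmx A0) (a b : R)
  (ha : a = \tr (invmx A0)) (hb : b = \tr (invmx A0 *m invmx A0))
  (q : int) (hq : q%:~R < a ^+ 2 / b <= q%:~R + 1) :
  let Q : R := q%:~R in
  let lstar : R :=
    a^-1 * (Q * (Q + 1) /
            (Q + Num.sqrt (Q * ((Q + 1) * (b / a ^+ 2) - 1)))) in
  exists l : m.-tuple (\bar R),
    [/\ l \in spectra m a b,
        forall k : nat, (1 <= k <= m)%N -> k%:Z <= m%:Z - q - 1 ->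
          eigv l k = +oo%E,
        forall k : nat, (1 <= k <= m)%N -> m%:Z - q + 1 <= k%:Z ->
          eigv l k = eigv l m,
        forall l' : m.-tuple (\bar R), l' \in spectra m a b ->
          (eigv l' m <= eigv l m)%E
      & eigv l m = lstar%:E].
Proof.
move=> Q lstar.
have m0 : (0 < m)%N by exact: ltnW.
have Bpd := posdefmx_inv hA0.
have a0 : 0 < a by rewrite ha posdefmx_trace_gt0.
have b0 : 0 < b by rewrite hb posdefmx_trace_sqr_gt0.
have lt_b_a2 : b < a ^+ 2 by rewrite ha hb posdefmx_trace_sqr_lt.
have le_a2_mb : a ^+ 2 <= m%:R * b by rewrite ha hb trace_sqr_le ?posdefmx_tr.
have /andP[lt_q le_q] := hq.
(* The trace inequalities place [q] between [1] and [m - 1]. *)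
have q_gt0 : 0 < q.
  rewrite -(ltr0z R) -(ltrD2r 1) add0r (lt_le_trans _ le_q) //.
  by rewrite ltr_pdivlMr // mul1r.
case: q q_gt0 hq lt_q le_q @Q @lstar => // n; rewrite ltz_nat => n0 hq lt_n _.
rewrite /= in hq lt_n *; set N : R := n%:~R in hq lt_n *.
have NE : N = n%:R by [].
have N0 : 0 < N by rewrite NE ltr0n.
have nm : (n < m)%N.
  by rewrite -(ltr_nat R) (lt_le_trans lt_n) // ler_pdivrMr.
set s := Num.sqrt _.
have [] := two_level_solution N0 a0 b0 hq; rewrite -/s.
set x := a * (1 - s) / (N + 1); set y := a * (N + s) / (N * (N + 1)).
move=> x0 xy sum1 sum2.
have y0 : 0 < y by exact: lt_le_trans xy.
pose d := (m - n)%N; pose z := step_profile d x y.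
have dm : (1 <= d < m)%N by rewrite /d; lia.
have mdE : (m - d)%:R = N by rewrite NE /d; congr _%:R; lia.
pose l : m.-tuple (\bar R) := [tuple ((z i.+1)%:E^-1)%E | i < m].
have lE k : (1 <= k <= m)%N -> eigv l k = ((z k)%:E^-1)%E.
  case: k => // k km; rewrite /eigv /= -[k in LHS]/(nat_of_ord (Ordinal km)).
  by rewrite nth_mktuple.
have zm : z m = y.
  by rewrite /z /step_profile; case: ltngtP => // md; exfalso; lia.
have z_ge0 k : 0 <= z k.
  by rewrite /z /step_profile; case: ltngtP => _ //; exact: ltW.
have z_incr j k : (j <= k)%N -> z j <= z k.
  rewrite /z /step_profile => jk.
  by case: (ltngtP j d) => jd; case: (ltngtP k d) => kd //;
    first [exact: ltW | exfalso; lia].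
have sumz1 : \sum_(1 <= k < m.+1) z k = a.
  by rewrite (@sum_step_profile R m d x y id) ?mdE //; lia.
have sumz2 : \sum_(1 <= k < m.+1) z k ^+ 2 = b.
  rewrite (@sum_step_profile R m d x y (fun t => t ^+ 2)) ?mdE ?expr0n //.
  by lia.
have mm : (1 <= m <= m)%N by rewrite leqnn m0.
exists l; split.
- apply/spectraP; exists z; split=> // [k km | j k _ jk _]; first by rewrite lE.
  exact: z_incr.
- move=> k km kd; rewrite lE // /z /step_profile ifT ?inve0 // /d; lia.
- move=> k km kd; rewrite !lE // zm /z /step_profile.
  by case: ltngtP; rewrite // /d; lia.
- move=> l' /spectraP[mu [muP mu_incr mu1 mu2]].
  have [mu_m ->] := muP m mm; rewrite lE // inve_fin_le // zm.
  apply: (@step_profile_max_le R m d x) => //.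
  + by move=> k /muP[].
  + by rewrite mu1 -sumz1.
  + by rewrite mu2 -sumz2.
- rewrite lE // zm inver gt_eqF //; congr _%:E.
  by rewrite /y invf_div invfM mulrCA.
Qed.
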